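(* Let $(A',\circ,B'(\cdot,\cdot))$ be a $2$-dimensional nontrivial quadratic Novikov algebra over $\mathbb{C}$. Then there exist $k\in\mathbb{C}$ and $s\in\mathbb{C}\setminus\{0\}$ such that $(A',\circ,B'(\cdot,\cdot))$ is isomorphic to the quadratic Novikov algebra $(A=\mathbb{C}e_1\oplus\mathbb{C}e_2,\circ,B(\cdot,\cdot))$ defined by $$e_1\circ e_1=0,\quad e_1\circ e_2=e_1,\quad e_2\circ e_1=-2e_1,\quad e_2\circ e_2=e_2,$$ $$B(e_1,e_1)=k,\quad B(e_1,e_2)=B(e_2,e_1)=s,\quad B(e_2,e_2)=0.$$
   Context: A Novikov algebra $(A,\circ)$ over $\mathbb{C}$ is a $\mathbb{C}$-vector space with a bilinear operation $\circ$ such that $(a\circ b)\circ c-a\circ(b\circ c)=(b\circ a)\circ c-b\circ(a\circ c)$ and $(a\circ b)\circ c=(a\circ c)\circ b$ for all $a,b,c\in A$. It is trivial if $a\circ b=0$ for all $a,b\in A$, and nontrivial otherwise. Put $a\star b:=a\circ b+b\circ a$. A quadratic Novikov algebra $(A,\circ,B(\cdot,\cdot))$ is a Novikov algebra with a nondegenerate symmetric bilinear form $B:A\times A\to\mathbb{C}$ such that $B(a\circ b,c)=-B(b,a\star c)$ for all $a,b,c\in A$; it is nontrivial if $(A,\circ)$ is nontrivial. An isomorphism of quadratic Novikov algebras $(A_1,\circ,B_1)\to(A_2,\circ,B_2)$ is a linear bijection $\varphi$ with $\varphi(a\circ b)=\varphi(a)\circ\varphi(b)$ and $B_1(a,b)=B_2(\varphi(a),\varphi(b))$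 for all $a,b\in A_1$. *)

(* Defs.v *)
From HB Require Import structures.
From mathcomp Require Import all_boot all_order all_algebra.
From mathcomp Require Import reals.
From mathcomp Require Export complex.
From mathcomp Require Import ring.

Set Implicit Arguments.
Unset Strict Implicit.
Unset Printing Implicit Defensive.

Import GRing.Theory.
Local Open Scope ring_scope.

Definition novikov (F : fieldType) (A : lmodType F)
    (m : {bilinear A -> A -> A}) : Prop :=
  (forall a b c, m (m a b) c - m a (m b c) = m (m b a) c - m b (m a c)) /\
  (forall a b c, m (m a b) c = m (m a c) b).

Definition trivial_alg (F : fieldType) (A : lmodType F)
    (m : {bilinear A -> A -> A}) : Prop :=
  forall a b, m a b = 0.

Definition star (F : fieldType) (A : lmodType F)
    (m : {bilinear A -> A -> A}) (a b : A) : A :=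
  m a b + m b a.

(* [nondegenerate] is the library's notion, which asks for a finite-dimensional
   carrier. *)
Definition quadratic_novikov (F : fieldType) (A : vectType F)
    (m : {bilinear A -> A -> A}) (B : {symmetric A}) : Prop :=
  [/\ novikov m, nondegenerate B &
      forall a b c, B (m a b) c = - B b (star m a c)].

Definition quadratic_iso (F : fieldType) (A1 A2 : lmodType F)
    (m1 : {bilinear A1 -> A1 -> A1}) (B1 : {symmetric A1})
    (m2 : {bilinear A2 -> A2 -> A2}) (B2 : {symmetric A2}) : Prop :=
  exists phi : {linear A1 -> A2},
    [/\ bijective phi,
        forall a b, phi (m1 a b) = m2 (phi a) (phi b) &
        forall a b, B1 a b = B2 (phi a) (phi b)].

Section StandardModel.
Variable F : fieldType.
Implicit Types (k s : F) (x y : 'rV[F]_2).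

Definition e1 : 'rV[F]_2 := 'e_0.
Definition e2 : 'rV[F]_2 := 'e_1.

(* The bilinear maps determined by their values on (e1, e2); these values are
   listed in [std_mul_table] and [std_form_table]. *)
Definition std_mul x y : 'rV[F]_2 :=
  (x 0 0 * y 0 1 - 2 * (x 0 1 * y 0 0)) *: e1 + (x 0 1 * y 0 1) *: e2.

Definition std_form k s x y : F :=
  k * (x 0 0 * y 0 0) + s * (x 0 0 * y 0 1 + x 0 1 * y 0 0).

Fact std_mul_bilinear :
  bilinear_for (GRing.Scale.Law.clone _ _ *:%R _)
    (GRing.Scale.Law.clone _ _ *:%R _) std_mul.
Proof. by split=> u a x y; apply/rowP=> i; rewrite !mxE; ring. Qed.

HB.instance Definition _ :=
  bilinear_isBilinear.Build F 'rV[F]_2 'rV[F]_2 'rV[F]_2 _ _ std_mul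
    std_mul_bilinear.

Fact std_form_bilinear k s :
  bilinear_for (GRing.Scale.Law.clone _ _ *%R _)
    (GRing.Scale.Law.clone _ _ (idfun \; *%R) _) (std_form k s).
Proof. by split=> u a x y; rewrite /std_form /= !mxE; ring. Qed.

HB.instance Definition _ k s :=
  bilinear_isBilinear.Build F 'rV[F]_2 'rV[F]_2 F _ _ (std_form k s)
    (std_form_bilinear k s).

Fact std_form_sym k s x y :
  std_form k s x y = (-1) ^+ false * idfun (std_form k s y x).
Proof. by rewrite /std_form /=; ring. Qed.

HB.instance Definition _ k s :=
  isHermitianSesquilinear.Build F 'rV[F]_2 false idfun (std_form k s)
    (std_form_sym k s).

Lemma std_mul_table :
  [/\ std_mul e1 e1 = 0, std_mul e1 e2 = e1,
      std_mul e2 e1 = (- 2) *: e1 & std_mul e2 e2 = e2].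
Proof. by split; apply/rowP=> i; rewrite !mxE /=; ring. Qed.

Lemma std_form_table k s :
  [/\ std_form k s e1 e1 = k, std_form k s e1 e2 = s,
      std_form k s e2 e1 = s & std_form k s e2 e2 = 0].
Proof. by split; rewrite /std_form !mxE /=; ring. Qed.

End StandardModel.

(* Main.v *)
Require Import Defs.
From HB Require Import structures.
From mathcomp Require Import all_boot all_order all_algebra.
From mathcomp Require Import reals complex.
From mathcomp Require Import ring.

Set Implicit Arguments.
Unset Strict Implicit.
Unset Printing Implicit Defensive.

Import GRing.Theory Num.Theory.
Local Open Scope ring_scope.

(** Over an algebraically closed field the form has a hyperbolic basis [u, v].
  Invariance says that [f a b c = B (a o b) c] is symmetric in [a, c] and has
  vanishing cyclic sum, so in dimension 2 it depends on two scalars only, and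
  [u o u = p u], [u o v = q u - 2 p v], [v o u = p v - 2 q u], [v o v = q v].
  Right commutativity [(u o u) o v = (u o v) o u] then reads [4 p q u = 0], and
  up to exchanging [u] and [v] we may take [p = 0]. Rescaling [v] by [q^-1]
  gives the standard algebra, always with [k = 0] and [s = q^-1]. *)

(** * Symmetric forms and hyperbolic pairs *)

Section SymmetricForm.
Variables (F : fieldType) (A : vectType F) (B : {symmetric A}).

Lemma symmetricC a b : B a b = B b a.
Proof. by rewrite hermC expr0 mul1r. Qed.

Lemma symmetricDl a b c : B (a + b) c = B a c + B b c.
Proof. exact: linearDl. Qed.

Lemma symmetricZl t a b : B (t *: a) b = t * B a b.
Proof. exact: linearZl_LR. Qed.

Lemma symmetricDr a b c : B c (a + b) = B c a + B c b.
Proof. exact: linearDr. Qed.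

Lemma symmetricZr t a b : B b (t *: a) = t * B b a.
Proof. exact: linearZr_LR. Qed.

Definition symmetricE := (symmetricDl, symmetricDr, symmetricZl, symmetricZr).

Lemma nondegenerateP :
  reflect (forall a, (forall b, B a b = 0) -> a = 0) (nondegenerate B).
Proof.
rewrite /nondegenerate -subv0.
apply: (iffP subvP) => [rad0 a a0|rad0 a /mem_orthovP a0].
  by apply/eqP; rewrite -memv0; apply: rad0; apply/mem_orthovP => b _.
by rewrite memv0; apply/eqP/rad0 => b; apply: a0; rewrite memvf.
Qed.

Definition hyperbolic_pair u v := [/\ B u u = 0, B v v = 0 & B u v = 1].

Lemma hyperbolic_pairC u v : hyperbolic_pair u v -> hyperbolic_pair v u.
Proof. by case=> uu vv uv; split; rewrite // symmetricC. Qed.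

(** Pairing a relation [u = t *: v] with [v] would give [1 = 0], so [u, v] is a basis of the plane;
    isotropy makes pairing with one vector read off the coefficient of the other. *)
Lemma hyperbolic_pair_decomp u v : \dim {: A} = 2%N -> hyperbolic_pair u v ->
  forall a, a = B a v *: u + B a u *: v.
Proof.
move=> dimA [uu vv uv] a.
have uv_free : free [:: u; v].
  rewrite free_cons seq1_free span_seq1; apply/andP; split.
    apply/negP => /vlineP[t ut]; have := oner_neq0 F.
    by rewrite -uv {1}ut symmetricZl vv mulr0 eqxx.
  by apply: contra_eq_neq uv => ->; rewrite linear0r eq_sym oner_eq0.
have uv_basis : basis_of fullv [:: u; v].
  by rewrite basisEfree uv_free subvf dimA.
have := memvf a; rewrite -(span_basis uv_basis) span_cons span_seq1.
case/memv_addP => _ /vlineP[x ->] [_ /vlineP[y ->] ->].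
by rewrite !symmetricE uu vv uv [B v u]symmetricC uv !mulr0 !mulr1 addr0 add0r.
Qed.

End SymmetricForm.

Section HyperbolicPair.
Variables (F : numClosedFieldType) (A : vectType F) (B : {symmetric A}).

Lemma isotropic_vector : (1 < \dim {: A})%N ->
  exists2 u : A, u != 0 & B u u = 0.
Proof.
move=> dimA.
have [a [b ab_free]] : exists a b : A, free [:: a; b].
  have := basis_free (vbasisP {: A}).
  case: (vbasis _) => [[|a [|b s]]] /= /eqP sz; try by rewrite -sz in dimA.
  by rewrite -[[:: _, _ & _]]/([:: a; b] ++ s) => /catl_free; exists a, b.
have [bb|bb] := eqVneq (B b b) 0.
  by exists b => //; move: ab_free; rewrite free_cons seq1_free => /andP[].
(* [B (a + t *: b) (a + t *: b)] is quadratic in [t] with leading coefficient [B b b]; [d ^+ 2] is a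
   quarter of its discriminant, and the witness uses one of its roots. *)
pose d := sqrtC (B a b ^+ 2 - B a a * B b b).
exists (a + ((d - B a b) / B b b) *: b).
  move: ab_free; rewrite free_cons span_seq1 => /andP[+ _].
  apply: contraNneq => /eqP; rewrite addr_eq0 => /eqP ->.
  by rewrite rpredN rpredZ ?memv_line.
rewrite !symmetricE [B b a]symmetricC.
have dd : d ^+ 2 = B a b ^+ 2 - B a a * B b b by rewrite sqrtCK.
by field : dd.
Qed.

Lemma exists_hyperbolic_pair : (1 < \dim {: A})%N -> nondegenerate B ->
  exists u v, hyperbolic_pair B u v.
Proof.
move=> dimA /eqP rad0; have [u u0 uu] := isotropic_vector dimA.
have /mem_orthovPn[w _ uw] : u \notin orthov B fullv by rewrite rad0 memv0.
(* The multiple of [u] cancels [B w w], because [u] is isotropic; the outer factor makes the pairing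
   with [u] equal to 1. *)
exists u, ((B u w)^-1 *: (w + (- (B w w) / (2 * B u w)) *: u)).
have two0 : 2 != 0 :> F by rewrite pnatr_eq0.
by split; rewrite // !symmetricE uu ?[B w u]symmetricC; field; rewrite ?two0.
Qed.

End HyperbolicPair.

(** * The trilinear form of an invariant product *)

Section QuadraticNovikov.
Variables (F : numFieldType) (A : vectType F).
Variables (m : {bilinear A -> A -> A}) (B : {symmetric A}).
Hypothesis mB : quadratic_novikov m B.

Lemma quadratic_novikov_inv a b c :
  B (m a b) c + B (m a c) b + B (m c a) b = 0.
Proof.
have [_ _ ->] := mB.
by rewrite /star symmetricDr ![B b _]symmetricC -addrA addNr.
Qed.

(** Exchanging [a] and [c] in [quadratic_novikov_inv b c a] swaps its first two terms, so the third
    terms agree. *)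
Lemma quadratic_novikov_sym13 a b c : B (m a b) c = B (m c b) a.
Proof.
apply: (addrI (B (m b c) a + B (m b a) c)); rewrite quadratic_novikov_inv.
by rewrite [X in _ = X + _]addrC quadratic_novikov_inv.
Qed.

Lemma quadratic_novikov_cyclic a b c :
  B (m a b) c + B (m b c) a + B (m c a) b = 0.
Proof. by rewrite [B (m b c) a]quadratic_novikov_sym13 quadratic_novikov_inv. Qed.

Lemma quadratic_novikov_aaa a : B (m a a) a = 0.
Proof.
(* The cyclic sum is three times one term, and the characteristic is zero. *)
have /eqP := quadratic_novikov_cyclic a a a.
by rewrite -mulr2n -mulrSr mulrn_eq0 => /eqP.
Qed.

Lemma quadratic_novikov_aba a b : B (m a b) a = - 2 * B (m a a) b.
Proof.
have /eqP := quadratic_novikov_cyclic a b a.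
rewrite [B (m b a) a]quadratic_novikov_sym13 -addrA addr_eq0 => /eqP ->.
by rewrite mulNr mulr2n mulrDl mul1r.
Qed.

Lemma quadratic_novikov_baa a b : B (m b a) a = B (m a a) b.
Proof. exact: quadratic_novikov_sym13. Qed.

End QuadraticNovikov.

Lemma hyperbolic_pair_table (F : numFieldType) (A : vectType F)
    (m : {bilinear A -> A -> A}) (B : {symmetric A}) (u v : A) :
  \dim {: A} = 2%N -> quadratic_novikov m B -> hyperbolic_pair B u v ->
  exists p q : F,
    [/\ m u u = p *: u, m u v = q *: u - (2 * p) *: v,
        m v u = p *: v - (2 * q) *: u, m v v = q *: v & p * q = 0].
Proof.
move=> dimA mB uv; have [uu vv uv1] := uv.
have decomp := hyperbolic_pair_decomp dimA uv.
pose p := B (m u u) v; pose q := B (m v v) u.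
have muu : m u u = p *: u.
  by rewrite [LHS]decomp (quadratic_novikov_aaa mB) scale0r addr0.
have mvv : m v v = q *: v.
  by rewrite [LHS]decomp (quadratic_novikov_aaa mB) scale0r add0r.
have muv : m u v = q *: u - (2 * p) *: v.
  rewrite [LHS]decomp (quadratic_novikov_baa mB) (quadratic_novikov_aba mB).
  by rewrite mulNr scaleNr.
have mvu : m v u = p *: v - (2 * q) *: u.
  rewrite [LHS]decomp (quadratic_novikov_baa mB) (quadratic_novikov_aba mB).
  by rewrite mulNr scaleNr addrC.
exists p, q; split => //.
have [[_ rcomm] _ _] := mB.
(* Pairing with [v] extracts the [u]-coordinates of both sides: [p * q] on the left,
   [p * q + 4 * (p * q)] on the right. *)
have := congr1 (B^~ v) (rcomm u u v).
rewrite /= muu muv linearBl !linearZl_LR /= muu muv mvu.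
rewrite -!scaleN1r !symmetricE uv1 vv => /eqP; rewrite -subr_eq0.
rewrite [X in X == 0](_ : _ = p * q * (- 4)); last by ring.
by rewrite mulf_eq0 oppr_eq0 pnatr_eq0 orbF => /eqP.
Qed.

(** * Identification with the standard algebra *)

Section StandardCoordinates.
Variables (F : fieldType) (A : vectType F) (B : {symmetric A}).
Variables (u v : A) (q : F).

(** For a hyperbolic pair spanning the plane and [q != 0], these are the coordinates in the basis
    [u], [q^-1 *: v], whose vectors correspond to [e1] and [e2]. *)
Definition std_coord (a : A) : 'rV[F]_2 :=
  B a v *: e1 F + (q * B a u) *: e2 F.

Fact std_coord_linear : linear std_coord.
Proof.
move=> t a b; apply/rowP => i; rewrite /std_coord !symmetricE !mxE; ring.
Qed.

HB.instance Definition _ :=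
  GRing.isLinear.Build F A 'rV[F]_2 _ std_coord std_coord_linear.

End StandardCoordinates.

Lemma row2_ext (T : Type) (x y : 'rV[T]_2) :
  x 0 0 = y 0 0 -> x 0 1 = y 0 1 -> x = y.
Proof.
move=> xy0 xy1; apply/rowP => -[[|[|//]] lti].
  by rewrite (_ : Ordinal lti = 0) //; apply/val_inj.
by rewrite (_ : Ordinal lti = 1) //; apply/val_inj.
Qed.

Lemma std_quadratic_novikov (F : fieldType) (s : F) : s != 0 ->
  quadratic_novikov (@std_mul F) (std_form 0 s).
Proof.
move=> s0; split.
- by split=> a b c; apply/rowP => i; rewrite !mxE /=; ring.
- apply/nondegenerateP => a a0.
  (* As [k = 0], pairing with [e2] and [e1] gives [s] times the first and second coordinate. *)
  have := a0 (e1 F); have := a0 (e2 F).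
  rewrite /= /std_form !mxE /= !(mul0r, mulr0, mulr1, add0r, addr0) => /eqP.
  rewrite mulf_eq0 (negPf s0) => /eqP a00 /eqP.
  rewrite mulf_eq0 (negPf s0) => /eqP a01.
  by apply: row2_ext; rewrite mxE.
- by move=> a b c; rewrite /= /std_form /star /= !mxE /=; ring.
Qed.

Lemma quadratic_iso_std (F : fieldType) (A : vectType F)
    (m : {bilinear A -> A -> A}) (B : {symmetric A}) (u v : A) (q : F) :
  \dim {: A} = 2%N -> hyperbolic_pair B u v -> q != 0 ->
  m u u = 0 -> m u v = q *: u -> m v u = (- (2 * q)) *: u -> m v v = q *: v ->
  quadratic_iso m B (@std_mul F) (std_form 0 q^-1).
Proof.
move=> dimA uv q0 muu muv mvu mvv; have [uu vv uv1] := uv.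
have decomp := hyperbolic_pair_decomp dimA uv.
exists (std_coord B u v q); split.
- exists (fun x : 'rV[F]_2 => x 0 0 *: u + (x 0 1 / q) *: v) => [a|x].
    rewrite [RHS]decomp /= !mxE /= !(mulr0, mulr1, addr0, add0r).
    by rewrite mulrAC divff // mul1r.
  apply: row2_ext; rewrite /= /std_coord !symmetricE !mxE /= ?[B v u]symmetricC;
  by rewrite uu vv uv1; field.
- move=> a b; rewrite {1}(decomp a) {1}(decomp b).
  rewrite !(linearDl, linearDr, linearZl_LR, linearZr_LR) /= muu muv mvu mvv.
  rewrite !scaler0 add0r; apply/rowP => i.
  rewrite /std_coord !symmetricE !mxE uu vv uv1 [B v u]symmetricC uv1 /=; ring.
- move=> a b; rewrite {1}(decomp a) {1}(decomp b) !(symmetricE B).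
  by rewrite [B v u]symmetricC uu vv uv1 /= /std_form !mxE /=; field.
Qed.

Lemma quadratic_novikov_dim2_std (F : numClosedFieldType) (A : vectType F)
    (m : {bilinear A -> A -> A}) (B : {symmetric A}) :
  \dim {: A} = 2%N ->
  quadratic_novikov m B ->
  ~ trivial_alg m ->
  exists k s : F,
    [/\ s != 0,
        quadratic_novikov (@std_mul F) (std_form k s) &
        quadratic_iso m B (@std_mul F) (std_form k s)].
Proof.
move=> dimA mB ntriv; have [_ ndB _] := mB.
have [u [v uv]] : exists u v, hyperbolic_pair B u v.
  by apply: exists_hyperbolic_pair; rewrite ?dimA.
have decomp := hyperbolic_pair_decomp dimA uv.
have [p [q [muu muv mvu mvv /eqP]]] := hyperbolic_pair_table dimA mB uv.
rewrite mulf_eq0; have [p0 _|p0 /= /eqP q0] := eqVneq p 0.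
  have q0 : q != 0.
    (* With [p = q = 0] all products of basis vectors vanish. *)
    apply/eqP => q0; apply: ntriv => a b; rewrite (decomp a) (decomp b).
    rewrite !(linearDl, linearDr, linearZl_LR, linearZr_LR) /= muu muv mvu mvv.
    by rewrite p0 q0 mulr0 !scale0r subrr !scaler0 !addr0.
  exists 0, q^-1; split; rewrite ?invr_eq0 //.
    by apply: std_quadratic_novikov; rewrite invr_eq0.
  apply: (quadratic_iso_std dimA uv) => //.
  - by rewrite muu p0 scale0r.
  - by rewrite muv p0 mulr0 scale0r subr0.
  - by rewrite mvu p0 scale0r add0r scaleNr.
(* The table is invariant under exchanging [(u, p)] with [(v, q)], so this case is the previous one
   for the reversed pair. *)
exists 0, p^-1; split; rewrite ?invr_eq0 //.
  by apply: std_quadratic_novikov; rewrite invr_eq0.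
apply: (quadratic_iso_std dimA (hyperbolic_pairC uv)) => //.
- by rewrite mvv q0 scale0r.
- by rewrite mvu q0 mulr0 scale0r subr0.
- by rewrite muv q0 scale0r add0r scaleNr.
Qed.

Theorem theorem3p6 (R : realType) (A' : vectType R[i])
    (m' : {bilinear A' -> A' -> A'}) (B' : {symmetric A'}) :
  \dim {: A'} = 2%N ->
  quadratic_novikov m' B' ->
  ~ trivial_alg m' ->
  exists k s : R[i],
    [/\ s != 0,
        quadratic_novikov (@std_mul R[i]) (std_form k s) &
        quadratic_iso m' B' (@std_mul R[i]) (std_form k s)].
Proof. exact: quadratic_novikov_dim2_std. Qed.
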